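(* There exists $\epsilon\in\mathbb{R}_{>0}$ such that for every sufficiently large $n\in\mathbb{N}$ and every $k\in[n]$, every Sums-of-Squares (SOS) refutation of $\mathrm{KS}_{n,k}$ has monomial size at least $2^{\epsilon k^2/n}$.
   Context: $[n]=\{1,\ldots,n\}$. $\mathrm{KS}_{n,k}$ denotes the Knapsack equation $2x_1+\cdots+2x_n=k$ on Boolean variables $x_1,\ldots,x_n$ (it is unsatisfiable for odd integers $k$), regarded as the single polynomial equality constraint $2x_1+\cdots+2x_n-k=0$. SOS proofs: polynomials are real polynomials in $2n$ commuting variables $x_1,\ldots,x_n,\bar{x}_1,\ldots,\bar{x}_n$ ($n$ pairs of twin variables); $B_n=\{x_i^2-x_i,\ \bar{x}_i^2-\bar{x}_i,\ x_i+\bar{x}_i-1 : i\in[n]\}$. For an indexed set of constraints $q_1\geq 0,\ldots,q_\ell\geq 0$, $p_1=0,\ldots,p_m=0$, an SOS refutation is a formal identity $$-1=s_0+\sum_{j\in[\ell]}s_jq_j+\sum_{j\in[m]}t_jp_j+\sum_{q\in B_n}u_qq,$$ where each $s_j=\sum_{i=1}^{k_j}r_{i,j}^2$ is given as a sum of squares of polynomials ($j\in\{0\}\cup[\ell]$) and $t_j,u_q$ are arbitrary polynomials. Its monomial size is $\sum_{j\in\{0\}\cup[\ell]}\sum_{i=1}^{k_j}\mathrm{size}(r_{i,j})+\sum_{j\in[m]}\mathrm{size}(t_j)$, where $\mathrm{size}(p)$ is the number of (nonzero) terms of $p$. (Here $\ell=0$ and $m=1$.) *)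

(* Defs.v *)
From mathcomp Require Import all_boot all_order all_algebra.
From mathcomp Require Import mpoly.
Import GRing.Theory.

Set Implicit Arguments.
Unset Strict Implicit.
Unset Printing Implicit Defensive.

Local Open Scope ring_scope.

(** Polynomials in [n] pairs of twin variables live in [{mpoly R[n + n]}]: the
    first [n] indeterminates are x_1, .., x_n, the last [n] their twins. *)

Section SOS.
Variables (R : nzRingType) (n : nat).

Definition var (i : 'I_n) : {mpoly R[n + n]} := 'X_(lshift n i).
Definition twin (i : 'I_n) : {mpoly R[n + n]} := 'X_(rshift n i).

Definition var_axiom (i : 'I_n) : {mpoly R[n + n]} := var i ^+ 2 - var i.
Definition twin_axiom (i : 'I_n) : {mpoly R[n + n]} := twin i ^+ 2 - twin i.
Definition pair_axiom (i : 'I_n) : {mpoly R[n + n]} := var i + twin i - 1.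

(** The number of terms with nonzero coefficient; the support [msupp p] is
    duplicate-free. *)
Definition mon_size (p : {mpoly R[n + n]}) : nat := size (msupp p).

Definition sum_of_squares (rs : seq {mpoly R[n + n]}) : {mpoly R[n + n]} :=
  \sum_(r <- rs) r ^+ 2.

(** Refutations of the constraints [q_j >= 0] (j < l) and [p_j = 0] (j < m).
    Sums of squares are given by the list of the polynomials being squared. *)
Record sos_refutation (l m : nat) (q : l.-tuple {mpoly R[n + n]})
    (p : m.-tuple {mpoly R[n + n]}) := SosRefutation {
  sos_s0 : seq {mpoly R[n + n]};
  sos_s : 'I_l -> seq {mpoly R[n + n]};
  sos_t : 'I_m -> {mpoly R[n + n]};
  sos_uvar : 'I_n -> {mpoly R[n + n]};
  sos_utwin : 'I_n -> {mpoly R[n + n]};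
  sos_upair : 'I_n -> {mpoly R[n + n]};
  sos_identity :
    -1 = sum_of_squares sos_s0
         + \sum_(j < l) sum_of_squares (sos_s j) * tnth q j
         + \sum_(j < m) sos_t j * tnth p j
         + (\sum_(i < n) sos_uvar i * var_axiom i
            + \sum_(i < n) sos_utwin i * twin_axiom i
            + \sum_(i < n) sos_upair i * pair_axiom i)
}.

(** The multipliers of the Boolean axioms are not counted. *)
Definition monomial_size (l m : nat) (q : l.-tuple {mpoly R[n + n]})
    (p : m.-tuple {mpoly R[n + n]}) (P : sos_refutation q p) : nat :=
  (\sum_(r <- sos_s0 P) mon_size r
   + \sum_(j < l) \sum_(r <- sos_s P j) mon_size r
   + \sum_(j < m) mon_size (sos_t P j))%N.

Definition knapsack (k : nat) : {mpoly R[n + n]} :=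
  (\sum_(i < n) 2%:R * var i) - k%:R.

Definition knapsack_refutation (k : nat) : Type :=
  sos_refutation [tuple] [tuple knapsack k].

End SOS.

(* Main.v *)
(** A refutation is evaluated on the Boolean points, where the Boolean axioms
    vanish, after a partial assignment setting a set [H1] of at most [k/4]
    variables to 1 and a set [H0] of at most [k/4] variables to 0.  Greedily
    chosen, each step of [H1] (resp. [H0]) falsifies a fraction [d/n] of the
    remaining monomials containing at least [d] twins (resp. unset variables).
    So if the size is less than [(1 - d/n)^-(k/4)] with [d ~ k/16], all the
    surviving monomials have degree at most [2d].

    On the [N] remaining variables the constraint is [x_1 + .. + x_N = rho].
    Low-degree refutations are excluded by the signed measure for which
    [E[x_A * twin_B] = rho^_a (N - rho)^_b / N^_(a + b)], with falling powers
    and [a = #|A|], [b = #|B|].  It is orthogonal to the constraint.  For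
    positivity, modulo the constraint a polynomial of degree at most [D] is
    [f = \sum_(#|S| = D) c_S x_S].  As [x_S x_S' = x_(S :|: S')], expanding
    [E[x_(S :|: S')]] by [x + twin = 1] over the elements of [S :&: S'] gives
    [E[f^2] = \sum_U E_(2D - #|U|, #|U|) * (\sum_(S \supset U) c_S)^2], where
    [E_(a, b)] is the above value; these are nonnegative as long as [2D] is at
    most [rho] and [N - rho].  *)

Require Import Defs.
From mathcomp Require Import all_boot all_order all_algebra.
From mathcomp Require Import reals.
From mathcomp Require exp.
From mathcomp Require Import mpoly ring lra zify.
Import Order.TTheory GRing.Theory Num.Theory.

Set Implicit Arguments.
Unset Strict Implicit.
Unset Printing Implicit Defensive.

Local Open Scope ring_scope.

(** * Sums over subcubes of the Boolean cube *)

Lemma disjoint_setU1 (T : finType) (i : T) (A X : {set T}) :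
  [disjoint i |: A & X] = (i \notin X) && [disjoint A & X].
Proof. by rewrite !disjoints_subset subUset sub1set inE. Qed.

(** Induction on the number of elements of [F] outside [A :|: B]: the sum is split on the membership
    of one such element in [X], which is what the recursion on [e] mirrors. When none is left, only
    [X = A] remains. *)
Lemma sum_subcube (R : nmodType) (T : finType) (F : {set T})
    (e : nat -> nat -> R) (A B : {set T}) :
  (forall a b, (a + b < #|F|)%N -> e a b = e a.+1 b + e a b.+1) ->
  A \subset F -> B \subset F -> [disjoint A & B] ->
  \sum_(X : {set T} | [&& X \subset F, A \subset X & [disjoint B & X]])
     e #|X| (#|F| - #|X|)%N = e #|A| #|B|.
Proof.
move=> eD AF BF dAB; have [k] := ubnP (#|F| - (#|A| + #|B|))%N.
elim: k A B AF BF dAB => // k IH A B AF BF dAB lek.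
have cardU : #|A :|: B| = (#|A| + #|B|)%N.
  by rewrite cardsU (disjoint_setI0 dAB) cards0 subn0.
have sUF : A :|: B \subset F by rewrite subUset AF.
have [FU | ] := boolP (F \subset A :|: B).
  have defF : F = A :|: B by apply/eqP; rewrite eqEsubset FU.
  rewrite (big_pred1 A) => [|X /=]; last first.
    apply/and3P/eqP => [[XF AX BX] | ->].
      apply/eqP; rewrite eqEsubset AX andbT; apply/subsetP=> x xX.
      have := subsetP XF x xX; rewrite defF inE => /orP[//|xB].
      by have := disjointFr BX xB; rewrite xX.
    by split=> //; rewrite disjoint_sym.
  by rewrite {1}defF cardU addKn.
case/subsetPn=> i iF; rewrite inE negb_or => /andP[iA iB].
have ltU : (#|A| + #|B| < #|F|)%N.
  rewrite -cardU; apply/proper_card/properP; split=> //.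
  by exists i => //; rewrite inE negb_or iA.
rewrite eD // (bigID (fun X : {set T} => i \in X)) /=; congr (_ + _).
  have cA : #|i |: A| = #|A|.+1 by rewrite cardsU1 iA.
  rewrite -cA -IH ?cA //; last 1 first.
  - lia.
  - by apply: eq_bigl => X; rewrite subUset sub1set -!andbA; do !bool_congr.
  - by rewrite subUset sub1set iF.
  - by rewrite disjoint_setU1 iB.
have cB : #|i |: B| = #|B|.+1 by rewrite cardsU1 iB.
rewrite -cB -IH ?cB //; last 1 first.
- lia.
- by apply: eq_bigl => X; rewrite disjoint_setU1 -!andbA; do !bool_congr.
- by rewrite subUset sub1set iF.
- by rewrite disjoint_sym disjoint_setU1 iA disjoint_sym.
Qed.

(** * Functionals on the subsets of [F], and low-degree functions *)

Section Functional.
Variables (R : realFieldType) (T : finType) (F : {set T}).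
Variables (e : nat -> nat -> R) (rho : R) (d : nat).

(* [e a b] is meant to be the expectation of a product of [a] variables and [b]
   twins; its values at [a + b = #|F|] are then the weights of the points. *)
Definition ev (f : {set T} -> R) : R :=
  \sum_(X : {set T} | X \subset F) e #|X| (#|F| - #|X|)%N * f X.

(** The multilinear monomial x_A, evaluated at the indicator point of [X]. *)
Definition inc (A X : {set T}) : R := (A \subset X)%:R.

Definition lowdeg (j : nat) (f : {set T} -> R) : Prop :=
  exists c : {set T} -> R, forall X : {set T}, X \subset F ->
    f X = \sum_(A : {set T} | (A \subset F) && (#|A| <= j)%N) c A * inc A X.

Definition uniform_comb (c : {set T} -> R) (X : {set T}) : R :=
  \sum_(S : {set T} | (S \subset F) && (#|S| == d)) c S * inc S X.

Lemma eq_ev f g :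
  (forall X : {set T}, X \subset F -> f X = g X) -> ev f = ev g.
Proof. by move=> fg; apply: eq_bigr => X /fg ->. Qed.

Lemma ev_sum (I : finType) (P : pred I) (a : I -> R) (f : I -> {set T} -> R) :
  ev (fun X => \sum_(i | P i) a i * f i X) = \sum_(i | P i) a i * ev (f i).
Proof.
under eq_bigr do rewrite mulr_sumr.
rewrite exchange_big /=; apply: eq_bigr => i _.
by rewrite mulr_sumr; apply: eq_bigr => X _; rewrite mulrCA.
Qed.

Lemma evD f g : ev (fun X => f X + g X) = ev f + ev g.
Proof. by rewrite -big_split; apply: eq_bigr => X _; rewrite mulrDr. Qed.

Lemma evZ a f : ev (fun X => a * f X) = a * ev f.
Proof. by rewrite mulr_sumr; apply: eq_bigr => X _; rewrite mulrCA. Qed.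

Lemma inc_mul A B X : inc A X * inc B X = inc (A :|: B) X.
Proof. by rewrite /inc subUset -natrM mulnb. Qed.

Lemma lowdeg0 j : lowdeg j (fun=> 0).
Proof.
by exists (fun=> 0) => X _; rewrite big1 // => A _; rewrite mul0r.
Qed.

Lemma lowdegD j f g :
  lowdeg j f -> lowdeg j g -> lowdeg j (fun X => f X + g X).
Proof.
move=> [c fc] [c' gc']; exists (fun A => c A + c' A) => X XF.
by rewrite fc // gc' // -big_split; apply: eq_bigr => A _; rewrite mulrDl.
Qed.

Lemma lowdegZ j a f : lowdeg j f -> lowdeg j (fun X => a * f X).
Proof.
move=> [c fc]; exists (fun A => a * c A) => X XF.
by rewrite fc // mulr_sumr; apply: eq_bigr => A _; rewrite mulrA.
Qed.

Lemma lowdeg_sum (I : eqType) (s : seq I) j (f : I -> {set T} -> R) :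
  (forall i, i \in s -> lowdeg j (f i)) ->
  lowdeg j (fun X => \sum_(i <- s) f i X).
Proof.
elim: s => [_|i s IH fs].
  by have [c fc] := lowdeg0 j; exists c => X /fc <-; rewrite big_nil.
have [c fc] : lowdeg j (fun X => f i X + \sum_(i <- s) f i X).
  by apply: lowdegD; [|apply: IH => k ks]; apply: fs; rewrite inE ?eqxx ?ks ?orbT.
by exists c => X XF; rewrite big_cons fc.
Qed.

Lemma lowdeg_inc j (A : {set T}) :
  A \subset F -> (#|A| <= j)%N -> lowdeg j (inc A).
Proof.
move=> AF Aj; exists (fun B => (B == A)%:R) => X _.
rewrite (bigD1 A) ?AF //= eqxx mul1r big1 ?addr0 // => B /andP[_ /negPf->].
by rewrite mul0r.
Qed.

(** The twins are removed one at a time through twin_i = 1 - x_i; neither of the two resulting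
    products has more than #|A| + #|B| literals. *)
Lemma lowdeg_literals j (A B : {set T}) :
  A \subset F -> B \subset F -> (#|A| + #|B| <= j)%N ->
  lowdeg j (fun X => ((A \subset X) && [disjoint B & X])%:R).
Proof.
have [k] := ubnP #|B|; elim: k A B => // k IH A B ltBk AF BF leABj.
have [->|[i iB]] := set_0Vmem B.
  have [c ac] := lowdeg_inc AF (leq_trans (leq_addr _ _) leABj).
  by exists c => X /ac <-; rewrite /inc disjoints_subset sub0set andbT.
have cB := cardsD1 i B; rewrite iB in cB.
have B'F : B :\ i \subset F by apply: subset_trans BF; apply: subsetDl.
have iF : i \in F by apply: subsetP BF _ iB.
have cA : (#|i |: A| <= #|A|.+1)%N by rewrite cardsU1; case: (_ \notin _).
have [||||c1 c1E] := IH A (B :\ i); [lia|by []|by []|lia|].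
have [||||c2 c2E] := IH (i |: A) (B :\ i);
  [lia|by rewrite subUset sub1set iF|by []|lia|].
have [c cE] := lowdegD (ex_intro _ c1 c1E) (lowdegZ (-1) (ex_intro _ c2 c2E)).
exists c => X XF; rewrite -cE // -[in LHS](setD1K iB) disjoint_setU1.
rewrite subUset sub1set; case: (i \in X); case: (A \subset X) => /=;
  case: [disjoint B :\ i & X]; ring.
Qed.

(** * Orthogonality to the constraint, and positivity on squares *)

Hypothesis eD : forall a b, (a + b < #|F|)%N -> e a b = e a.+1 b + e a b.+1.
Hypothesis eK : forall a, (a < #|F|)%N ->
  (#|F|%:R - a%:R) * e a.+1 0 = (rho - a%:R) * e a 0.
Hypothesis dF : (d + d <= #|F|)%N.
Hypothesis d_rho : forall a, (a < d)%N -> a%:R < rho.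
Hypothesis e_ge0 : forall a b, (a + b = d + d)%N -> 0 <= e a b.

Lemma ev_inc (A : {set T}) : A \subset F -> ev (inc A) = e #|A| 0.
Proof.
move=> AF; rewrite -(cards0 T).
rewrite -(sum_subcube (e := e) eD AF (sub0set F)); last first.
  by rewrite disjoint_sym disjoints_subset sub0set.
rewrite big_mkcondr /=; apply: eq_bigr => X XF.
rewrite disjoints_subset sub0set andbT /inc.
by case: (A \subset X); rewrite ?mulr1 ?mulr0.
Qed.

(** Multiplying x_A by the sum of all x_i: indices in [A] reproduce x_A by idempotence, the others
    extend the monomial. *)
Lemma card_mul_inc (A X : {set T}) : A \subset F -> X \subset F ->
  #|X|%:R * inc A X = #|A|%:R * inc A X + \sum_(i in F :\: A) inc (i |: A) X.
Proof.
move=> AF XF; rewrite /inc.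
under eq_bigr => i _ do rewrite subUset sub1set -mulnb natrM.
rewrite -mulr_suml -natr_sum; case: (boolP (A \subset X)) => AX; last first.
  by rewrite !mulr0 add0r.
rewrite !mulr1 -natrD; congr _%:R.
rewrite -big_mkcondr sum1_card.
have -> : #|[pred i in F :\: A | i \in X]| = #|X :\: A|.
  apply: eq_card => i; rewrite !inE.
  by case: (boolP (i \in X)) => [/(subsetP XF)->|]; rewrite ?andbT ?andbF.
by rewrite cardsD (setIidPr AX) subnKC // subset_leq_card.
Qed.

(** After this expansion all extended monomials have the same value, so that the claim becomes [eK]
    at [#|A|]. *)
Lemma ev_knapsack (A : {set T}) : A \subset F -> (#|A| < #|F|)%N ->
  ev (fun X => (#|X|%:R - rho) * inc A X) = 0.
Proof.
move=> AF ltAF.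
rewrite (@eq_ev _ (fun X => (#|A|%:R - rho) * inc A X +
    \sum_(i in F :\: A) 1 * inc (i |: A) X)); last first.
  move=> X XF; rewrite mulrBl card_mul_inc //.
  by under [in RHS]eq_bigr do rewrite mul1r; ring.
rewrite evD evZ ev_sum ev_inc //.
rewrite (eq_bigr (fun=> e #|A|.+1 0)) => [|i]; last first.
  rewrite inE => /andP[iA iF].
  by rewrite mul1r ev_inc ?cardsU1 ?iA // subUset sub1set iF.
rewrite sumr_const cardsD (setIidPr AF) -[e _ _ *+ _]mulr_natl.
by rewrite natrB ?subset_leq_card // eK //; ring.
Qed.

Lemma ev_knapsack_lowdeg j f : (j < #|F|)%N -> lowdeg j f ->
  ev (fun X => (#|X|%:R - rho) * f X) = 0.
Proof.
move=> jF [c fc].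
rewrite (@eq_ev _ (fun X => \sum_(A : {set T} | (A \subset F) && (#|A| <= j)%N)
    c A * ((#|X|%:R - rho) * inc A X))); last first.
  move=> X XF; rewrite fc // mulr_sumr.
  by apply: eq_bigr => A _; rewrite mulrCA.
rewrite ev_sum big1 // => A /andP[AF Aj].
by rewrite ev_knapsack ?mulr0 // (leq_ltn_trans Aj).
Qed.

(* Congruent, modulo the knapsack constraint, to a combination of the [x_S] with
   [#|S| = d]; only tested against polynomials of degree at most [d]. *)
Definition uniformizable (f : {set T} -> R) : Prop :=
  exists c, forall B : {set T}, B \subset F -> (#|B| <= d)%N ->
    ev (fun X => f X * inc B X) = ev (fun X => uniform_comb c X * inc B X).

Lemma uniformizable_sum (I : finType) (P : pred I) (a : I -> R)
    (f : I -> {set T} -> R) :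
  (forall i, P i -> uniformizable (f i)) ->
  uniformizable (fun X => \sum_(i | P i) a i * f i X).
Proof.
move=> fP.
(* Choice over the whole finite type [I]; coefficients outside [P] default to 0. *)
have /fin_all_exists[c cP] i : exists c, P i -> forall B : {set T},
    B \subset F -> (#|B| <= d)%N ->
    ev (fun X => f i X * inc B X) = ev (fun X => uniform_comb c X * inc B X).
  case: (boolP (P i)) => [/fP[c ?]|_]; first by exists c.
  by exists (fun=> 0).
exists (fun S => \sum_(i | P i) a i * c i S) => B BF Bd.
rewrite (@eq_ev _ (fun X => \sum_(i | P i) a i * (f i X * inc B X))); last first.
  by move=> X _; rewrite mulr_suml; apply: eq_bigr => i _; rewrite mulrA.
rewrite ev_sum.
rewrite [RHS](@eq_ev _ (fun X => \sum_(i | P i) a i * (uniform_comb (c i) X * inc B X))).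
  by rewrite ev_sum; apply: eq_bigr => i Pi; rewrite cP.
move=> X _; under [RHS]eq_bigr do rewrite mulrA.
rewrite -mulr_suml; congr (_ * _); rewrite /uniform_comb.
under eq_bigr do rewrite mulr_suml.
rewrite exchange_big /=; apply: eq_bigr => i _; rewrite mulr_sumr.
by apply: eq_bigr => S _; rewrite mulrA.
Qed.

(** Modulo the constraint, (rho - #|A|) x_A is the sum of the x_(i |: A) over i outside [A].
    Dividing by the factor, nonzero by [d_rho], raises the degree by one until it reaches [d]. *)
Lemma uniformizable_inc (A : {set T}) :
  A \subset F -> (#|A| <= d)%N -> uniformizable (inc A).
Proof.
have [k] := ubnP (d - #|A|)%N; elim: k A => // k IH A ltk AF.
rewrite leq_eqVlt => /orP[/eqP Ad|ltAd].
  exists (fun S => (S == A)%:R) => B _ _; apply: eq_ev => X _; congr (_ * _).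
  rewrite /uniform_comb (bigD1 A) ?AF ?Ad ?eqxx //= mul1r big1 ?addr0 // => S.
  by case/andP=> _ /negPf->; rewrite mul0r.
have nz : rho - #|A|%:R != 0 by rewrite subr_eq0 gt_eqF // d_rho.
have [|c cP] := @uniformizable_sum _ [pred i in F :\: A]
    (fun=> (rho - #|A|%:R)^-1) (fun i => inc (i |: A)).
  move=> i; rewrite inE in_setD => /andP[iA iF].
  have cA : #|i |: A| = #|A|.+1 by rewrite cardsU1 iA.
  by apply: IH; rewrite ?cA // ?subUset ?sub1set ?iF //; lia.
exists c => B BF Bd; rewrite -cP //.
have UF : A :|: B \subset F by rewrite subUset AF.
have ltUF : (#|A :|: B| < #|F|)%N.
  by rewrite cardsU (leq_ltn_trans (leq_subr _ _)) //; lia.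
(* The constraint is tested against x_A * x_B = x_(A :|: B), whose degree is below #|F| because #|A|
   < d, #|B| <= d and 2d <= #|F|. *)
have /eqP := ev_knapsack UF ltUF.
rewrite (@eq_ev _ (fun X => (rho - #|A|%:R) * (((\sum_(i in F :\: A)
   (rho - #|A|%:R)^-1 * inc (i |: A) X) * inc B X) + -1 * (inc A X * inc B X)))).
  rewrite evZ mulf_eq0 (negPf nz) /= evD evZ mulN1r subr_eq0 => /eqP->.
  by [].
move=> X XF; rewrite -inc_mul mulrA mulrBl card_mul_inc //.
rewrite -mulr_sumr; set s := \sum_(i in _) _; field; exact: nz.
Qed.

(** Since [e] sees only cardinals, x_(S :|: S') may be expanded by x + twin = 1 over #|S :&: S'|
    fresh variables, which the elements of [S :&: S'] merely index. Then [U] marks the chosen twins,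
    and every term has total degree 2d. *)
Lemma e_union (S S' : {set T}) :
  S \subset F -> S' \subset F -> #|S| = d -> #|S'| = d ->
  e #|S :|: S'| 0 = \sum_(U : {set T} | (U \subset S) && (U \subset S'))
                      e (d + d - #|U|)%N #|U|.
Proof.
move=> SF S'F Sd S'd.
have cU : (#|S :|: S'| + #|S :&: S'| = d + d)%N.
  rewrite cardsU Sd S'd subnK // -Sd; apply: leq_trans (leq_addr _ _).
  exact/subset_leq_card/subsetIl.
(* The arguments of [e] are swapped here: elements of the summation set count as twins, the rest of
   [S :&: S'] as further variables. *)
have := @sum_subcube R T (S :&: S') (fun a b => e (#|S :|: S'| + b) a)%N set0 set0.
rewrite cards0 addn0 => <-; rewrite ?sub0set //; last 2 first.
- move=> a b ltab; rewrite [LHS]eD; last by lia.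
  by rewrite addrC addnS.
- by rewrite disjoints_subset sub0set.
apply: eq_big => [U|U /andP[US US']].
  by rewrite subsetI sub0set disjoints_subset sub0set !andbT.
by rewrite addnBA ?cU // subset_leq_card // subsetI US.
Qed.

Lemma ev_uniform_comb_sqr_ge0 c : 0 <= ev (fun X => uniform_comb c X * uniform_comb c X).
Proof.
pose P (S : {set T}) := (S \subset F) && (#|S| == d).
have -> : ev (fun X => uniform_comb c X * uniform_comb c X) =
    \sum_(U : {set T} | (#|U| <= d)%N) e (d + d - #|U|)%N #|U| *
      (\sum_(S : {set T} | P S && (U \subset S)) c S) ^+ 2.
  transitivity (\sum_(S | P S) \sum_(S' | P S') c S * c S' * e #|S :|: S'| 0).
    rewrite (@eq_ev _ (fun X => \sum_(S | P S) c S *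
        \sum_(S' | P S') c S' * inc (S :|: S') X)); last first.
      move=> X _; rewrite mulr_suml; apply: eq_bigr => S _.
      rewrite -mulrA; congr (_ * _); rewrite mulr_sumr; apply: eq_bigr => S' _.
      by rewrite -inc_mul mulrCA.
    rewrite ev_sum; apply: eq_bigr => S /andP[SF _]; rewrite ev_sum mulr_sumr.
    apply: eq_bigr => S' /andP[S'F _].
    by rewrite ev_inc ?mulrA // subUset SF.
  (* The conditions on [U] are moved onto the two coefficients separately, so that for fixed [U] the
     double sum factors as a square. *)
  transitivity (\sum_(S | P S) \sum_(S' | P S') \sum_(U : {set T} | (#|U| <= d)%N)
      e (d + d - #|U|)%N #|U| *
      ((if U \subset S then c S else 0) * (if U \subset S' then c S' else 0))).
    apply: eq_bigr => S /andP[SF /eqP Sd]; apply: eq_bigr => S' /andP[S'F /eqP S'd].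
    rewrite e_union // mulr_sumr [LHS]big_mkcond [RHS]big_mkcond /=;
    apply: eq_bigr => U _.
    case: (boolP (U \subset S)) => [US|_]; last by rewrite mul0r mulr0 if_same.
    rewrite -Sd (subset_leq_card US).
    by case: (U \subset S') => /=; rewrite ?mulr0 // mulrC.
  under eq_bigr do rewrite exchange_big /=.
  rewrite exchange_big /=; apply: eq_bigr => U _.
  rewrite expr2 [X in X * X]big_mkcondr mulr_suml mulr_sumr; apply: eq_bigr => S _.
  by rewrite !mulr_sumr.
apply: sumr_ge0 => U Ud; apply: mulr_ge0; last exact: sqr_ge0.
by apply: e_ge0; lia.
Qed.

(** With g the uniform combination congruent to f, E[f f] = E[g f] = E[f g] = E[g g]: the congruence
    is used twice, each time against a factor of degree at most [d]. *)
Lemma ev_sqr_ge0 f : lowdeg d f -> 0 <= ev (fun X => f X ^+ 2).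
Proof.
move=> [c fc].
have [|c' c'P] := @uniformizable_sum _
    (fun A : {set T} => (A \subset F) && (#|A| <= d)%N) c (fun A => inc A).
  by move=> A /andP[]; apply: uniformizable_inc.
have fc' (B : {set T}) : B \subset F -> (#|B| <= d)%N ->
    ev (fun X => f X * inc B X) = ev (fun X => uniform_comb c' X * inc B X).
  by move=> BF Bd; rewrite -c'P //; apply: eq_ev => X /fc ->.
suff -> : ev (fun X => f X ^+ 2) = ev (fun X => uniform_comb c' X * uniform_comb c' X).
  exact: ev_uniform_comb_sqr_ge0.
have swap (P : pred {set T}) (g : {set T} -> R) (a : {set T} -> R) :
    (forall B, P B -> (B \subset F) && (#|B| <= d)%N) ->
    (forall X : {set T}, X \subset F -> g X = \sum_(B | P B) a B * inc B X) ->
    ev (fun X => f X * g X) = ev (fun X => uniform_comb c' X * g X).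
  move=> PB gE.
  rewrite (@eq_ev _ (fun X => \sum_(B | P B) a B * (f X * inc B X))); last first.
    move=> X XF; rewrite gE // mulr_sumr.
    by apply: eq_bigr => B _; rewrite mulrCA.
  rewrite [RHS](@eq_ev _ (fun X => \sum_(B | P B) a B * (uniform_comb c' X * inc B X))).
    by rewrite !ev_sum; apply: eq_bigr => B /PB/andP[BF Bd]; rewrite fc'.
  move=> X XF; rewrite gE // mulr_sumr.
  by apply: eq_bigr => B _; rewrite mulrCA.
rewrite (swap (fun A => (A \subset F) && (#|A| <= d)%N) f c) //.
rewrite (@eq_ev _ (fun X => f X * uniform_comb c' X)); last by move=> X _; rewrite mulrC.
apply: (swap (fun S => (S \subset F) && (#|S| == d)) _ c') => //.
by move=> S /andP[-> /eqP->] /=.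
Qed.

End Functional.

(** * Greedy hitting sets *)

(** By averaging over [G], some element lies in at least a fraction d / #|T| of the sets; it is
    added to [H], and the induction continues with the sets that avoid it. *)
Lemma hitting_set (T : finType) (G : {set T}) (d m : nat) (Ss : seq {set T}) :
  (0 < d)%N -> (forall S, S \in Ss -> d <= #|S :&: G|)%N ->
  exists H : {set T}, [/\ H \subset G, (#|H| <= m)%N &
    (count (fun S : {set T} => [disjoint H & S]) Ss * #|T| ^ m <=
     size Ss * (#|T| - d) ^ m)%N].
Proof.
move=> d_gt0; elim: m Ss => [|m IH] Ss SsG.
  by exists set0; rewrite sub0set cards0 !expn0 !muln1 count_size.
have [->|Ss0] := eqVneq Ss [::].
  by exists set0; rewrite sub0set cards0 /= !mul0n.
have [i iG hi] : exists2 i, i \in G &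
    (size Ss * d <= #|T| * count (fun S : {set T} => i \in S) Ss)%N.
  apply/exists_inP; apply: contraT => /exists_inPn noi.
  (* Double counting of the pairs (i, S) with i in [S :&: G]. *)
  have dbl : (\sum_(i in G) count (fun S : {set T} => i \in S) Ss =
              \sum_(S <- Ss) #|S :&: G|)%N.
    under eq_bigr do rewrite -sum1_count big_mkcond.
    rewrite exchange_big; apply: eq_bigr => S _; rewrite -big_mkcondr sum1_card.
    by apply: eq_card => i; rewrite !inE andbC.
  have [S0 S0s] : exists S0, S0 \in Ss.
    by case: (Ss) Ss0 => // S0 ? _; exists S0; rewrite inE eqxx.
  have G0 : (0 < #|G|)%N.
    have := leq_trans d_gt0 (SsG _ S0s) => /leq_trans; apply.
    exact/subset_leq_card/subsetIr.
  have lb : (size Ss * d <= \sum_(S <- Ss) #|S :&: G|)%N.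
    rewrite -sum1_size big_distrl /= [X in (X <= _)%N]big_seq [X in (_ <= X)%N]big_seq.
    by apply: leq_sum => S /SsG; rewrite mul1n.
  (* Each strict inequality between naturals contributes a 1, hence the extra #|G| > 0 that yields
     the contradiction. *)
  have ub : (\sum_(i in G) #|T| * count (fun S : {set T} => i \in S) Ss + #|G|
             <= #|G| * (size Ss * d))%N.
    rewrite -[X in (_ + X)%N]sum1_card -big_split -sum_nat_const.
    by apply: leq_sum => i /noi; rewrite -ltnNge /= addn1.
  rewrite -big_distrr /= dbl in ub.
  have : (#|G| * (size Ss * d) <= #|T| * \sum_(S <- Ss) #|S :&: G|)%N.
    by apply: leq_mul lb; apply: max_card.
  by rewrite leqNgt (leq_trans _ ub) // -addn1 leq_add2l.
have [|H [HG Hm HS]] := IH [seq S : {set T} <- Ss | i \notin S].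
  by move=> S; rewrite mem_filter => /andP[_ /SsG].
exists (i |: H); split.
- by rewrite subUset sub1set iG.
- by rewrite cardsU1; case: (_ \notin _); rewrite /= ?add1n ?add0n ?ltnS // ltnW.
have -> : count (fun S : {set T} => [disjoint i |: H & S]) Ss =
    count (fun S : {set T} => [disjoint H & S]) [seq S : {set T} <- Ss | i \notin S].
  rewrite count_filter; apply: eq_count => S /=.
  by rewrite disjoint_setU1 andbC.
have szE := count_predC (fun S : {set T} => i \in S) Ss.
have szF : size [seq S : {set T} <- Ss | i \notin S] = count (predC (fun S : {set T} => i \in S)) Ss.
  by rewrite size_filter.
rewrite -{}szF in szE; move: HS szE hi.
set c := count _ (filter _ _); set s' := size (filter _ _).
set h := count _ _; set N := #|T| => HS szE hi.
have le1 : (s' * N <= size Ss * (N - d))%N by nia.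
rewrite !expnS mulnCA (leq_trans (leq_mul (leqnn N) HS)) //.
by rewrite mulnA [(N * _)%N]mulnC mulnA leq_mul2r le1 orbT.
Qed.

(** * The weights given by quotients of falling powers *)

Section FallingWeights.
Variables (R : realFieldType) (N : nat) (rho : R).

Definition falling (x : R) (a : nat) : R := \prod_(i < a) (x - i%:R).

(* For integral [rho], the probability that [a] given variables are 1 and [b]
   others are 0 when a uniformly random set of [rho] of the [N] variables is
   set to 1. *)
Definition weight (a b : nat) : R :=
  falling rho a * falling (N%:R - rho) b / falling N%:R (a + b).

Lemma fallingS x a : falling x a.+1 = falling x a * (x - a%:R).
Proof. by rewrite /falling big_ord_recr. Qed.

Lemma falling_ge0 x a : a%:R <= x -> 0 <= falling x a.
Proof.
move=> ax; apply: prodr_ge0 => i _; rewrite subr_ge0 (le_trans _ ax) //.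
by rewrite ler_nat ltnW.
Qed.

Lemma falling_nat_gt0 a : (a <= N)%N -> 0 < falling N%:R a.
Proof.
move=> aN; apply: prodr_gt0 => i _; rewrite subr_gt0 ltr_nat.
exact: leq_trans (ltn_ord i) aN.
Qed.

(** Over a common denominator this is (rho - a) + (N - rho - b) = N - (a + b). *)
Lemma weightD a b : (a + b < N)%N ->
  weight a b = weight a.+1 b + weight a b.+1.
Proof.
move=> abN; rewrite /weight addnS addSn !fallingS.
have nz : falling N%:R (a + b) != 0 by rewrite gt_eqF // falling_nat_gt0 // ltnW.
have nz' : N%:R - (a + b)%:R != 0 :> R by rewrite subr_eq0 eqr_nat gtn_eqF.
rewrite natrD; field; rewrite -natrD.
by apply/andP.
Qed.

Lemma weightK a : (a < N)%N ->
  (N%:R - a%:R) * weight a.+1 0 = (rho - a%:R) * weight a 0.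
Proof.
move=> aN; rewrite /weight !addn0 !fallingS.
have nz : falling N%:R a != 0 by rewrite gt_eqF // falling_nat_gt0 // ltnW.
have nz' : N%:R - a%:R != 0 :> R by rewrite subr_eq0 eqr_nat gtn_eqF.
by field; apply/andP.
Qed.

Lemma weight_ge0 a b : a%:R <= rho -> b%:R <= N%:R - rho -> (a + b <= N)%N ->
  0 <= weight a b.
Proof.
move=> ? ? ?; apply: divr_ge0; last exact/ltW/falling_nat_gt0.
by apply: mulr_ge0; apply: falling_ge0.
Qed.

Lemma weight00 : weight 0 0 = 1.
Proof. by rewrite /weight /falling !big_ord0 mulr1 divr1. Qed.

End FallingWeights.

(** * Evaluation of refutations at Boolean points *)

Section Evaluation.
Variables (R : realFieldType) (n : nat).

Definition point (Y : {set 'I_n}) (i : 'I_(n + n)) : R :=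
  match split i with inl j => (j \in Y)%:R | inr j => (j \notin Y)%:R end.

Definition var_supp (m : 'X_{1..n + n}) : {set 'I_n} :=
  [set i | m (lshift n i) != 0%N].
Definition twin_supp (m : 'X_{1..n + n}) : {set 'I_n} :=
  [set i | m (rshift n i) != 0%N].

Lemma point_var Y i : (var R i).@[point Y] = (i \in Y)%:R.
Proof. by rewrite mevalXU /point -/(unsplit (inl i)) unsplitK. Qed.

Lemma point_twin Y i : (twin R i).@[point Y] = (i \notin Y)%:R.
Proof. by rewrite mevalXU /point -/(unsplit (inr i)) unsplitK. Qed.

Lemma prod_bool_expn (b : pred 'I_n) (k : 'I_n -> nat) :
  \prod_i ((b i)%:R : R) ^+ k i = [forall i, (k i != 0%N) ==> b i]%:R.
Proof.
case: forallP => [h|/forallP/forallPn[i]].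
  rewrite big1 // => i _; have := h i.
  by case: (k i) => [|j] //= ->; rewrite expr1n.
rewrite negb_imply => /andP[ki bi]; rewrite (bigD1 i) //= (negPf bi) expr0n.
by rewrite (negPf ki) mul0r.
Qed.

Lemma meval_monomial (m : 'X_{1..n + n}) Y :
  \prod_i point Y i ^+ m i =
  ((var_supp m \subset Y) && [disjoint twin_supp m & Y])%:R.
Proof.
rewrite big_split_ord -mulnb natrM; congr (_ * _).
  under eq_bigr do rewrite /point -/(unsplit (inl _)) unsplitK.
  rewrite prod_bool_expn; congr _%:R; congr nat_of_bool.
  by apply/forallP/subsetP => h i; have := h i; rewrite inE => /implyP.
under eq_bigr do rewrite /point -/(unsplit (inr _)) unsplitK.
rewrite prod_bool_expn disjoints_subset; congr _%:R; congr nat_of_bool.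
by apply/forallP/subsetP => h i; have := h i; rewrite !inE => /implyP.
Qed.

Variables (k : nat) (P : knapsack_refutation R n k).

Let t := sos_t P ord0.

(** Twins take complementary values at [point Y], so all Boolean axioms vanish there, whatever their
    multipliers. *)
Lemma refutation_at Y :
  -1 = \sum_(r <- sos_s0 P) r.@[point Y] ^+ 2 +
       t.@[point Y] * (2%:R * #|Y|%:R - k%:R).
Proof.
have := congr1 (meval (point Y)) (sos_identity P).
rewrite big_ord0 addr0 big_ord1 rmorphN1 !rmorphD /= !rmorph_sum /=.
rewrite [\sum_(i < n) (sos_uvar _ _ * _).@[_]]big1 => [|i _]; last first.
  by rewrite rmorphM rmorphB rmorphXn /= point_var; case: (_ \in _) => /=; ring.
rewrite [\sum_(i < n) (sos_utwin _ _ * _).@[_]]big1 => [|i _]; last first.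
  by rewrite rmorphM rmorphB rmorphXn /= point_twin; case: (_ \in _) => /=; ring.
rewrite [\sum_(i < n) (sos_upair _ _ * _).@[_]]big1 => [|i _]; last first.
  rewrite rmorphM rmorphB rmorphD /= point_var point_twin rmorph1.
  by case: (_ \in _) => /=; ring.
rewrite !addr0 => ->; congr (_ + _).
  by apply: eq_bigr => r _; rewrite rmorphXn.
rewrite rmorphM; congr (_ * _).
rewrite /tnth /= /knapsack rmorphB rmorph_sum rmorph_nat /=; congr (_ - _).
rewrite -sum1_card natr_sum mulr_sumr [RHS]big_mkcond; apply: eq_bigr => i _.
by rewrite rmorphM rmorph_nat /= point_var; case: (_ \in _); rewrite ?mulr0.
Qed.

(** Repetitions are kept, so that the length is exactly the monomial size. *)
Definition monomials : seq 'X_{1..n + n} :=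
  flatten [seq msupp r | r : {mpoly R[n + n]} <- sos_s0 P] ++ msupp t.

Lemma size_monomials : size monomials = monomial_size P.
Proof.
rewrite /monomial_size big_ord0 addn0 big_ord1 size_cat size_flatten; congr (_ + _)%N.
by rewrite /shape -map_comp sumnE big_map.
Qed.

End Evaluation.

(** Under the size hypothesis the number of missed sets is an integer below 1. *)
Lemma hitting_set_all (T : finType) (G : {set T}) (d m : nat) (Ss : seq {set T}) :
  (0 < d)%N -> (forall S, S \in Ss -> d <= #|S :&: G|)%N ->
  (size Ss * (#|T| - d) ^ m < #|T| ^ m)%N ->
  exists H : {set T}, [/\ H \subset G, (#|H| <= m)%N &
    forall S, S \in Ss -> ~~ [disjoint H & S]].
Proof.
move=> d_gt0 SsG ltm; have [H [HG Hm HS]] := hitting_set m d_gt0 SsG.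
exists H; split=> // S SSs; apply/negP=> dHS.
have : (0 < count (fun S : {set T} => [disjoint H & S]) Ss)%N.
  by rewrite -has_count; apply/hasP; exists S.
by move=> c_gt0; move: (leq_ltn_trans HS ltm); rewrite ltnNge leq_pmull.
Qed.

(** * Restriction to low degree and the resulting size bound *)

Section LowerBound.
Variables (R : realFieldType) (n k d m : nat) (P : knapsack_refutation R n k).
Hypotheses (d_gt0 : (0 < d)%N) (dmk : (8 * d + 2 * m <= k)%N) (kn : (k <= n)%N).

Lemma restriction_exists :
  (monomial_size P * (n - d) ^ m < n ^ m)%N ->
  exists H1 H0 : {set 'I_n},
    [/\ H0 \subset ~: H1, (#|H1| <= m)%N, (#|H0| <= m)%N &
    forall mo, mo \in monomials P ->
      ~~ [disjoint H1 & twin_supp mo] \/ (#|twin_supp mo| <= d)%N /\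
      (~~ [disjoint H0 & var_supp mo] \/ (#|var_supp mo :&: ~: H1| <= d)%N)].
Proof.
rewrite -size_monomials => lt_size.
have small (f : 'X_{1..n + n} -> {set 'I_n}) (p : pred 'X_{1..n + n}) :
    (size [seq f mo | mo <- monomials P & p mo] * (#|'I_n| - d) ^ m < #|'I_n| ^ m)%N.
  rewrite card_ord size_map (leq_ltn_trans _ lt_size) // leq_mul2r.
  by rewrite size_filter count_size orbT.
have [|H1 [_ H1m H1P]] := hitting_set_all (G := setT) d_gt0 _
    (small (@twin_supp n) (fun mo => d <= #|twin_supp mo|)%N).
  by move=> S /mapP[mo]; rewrite mem_filter setIT => /andP[? _] ->.
(* Choosing [H0] inside the complement of [H1] keeps the two partial assignments compatible; only
   variables not yet set to 1 count for the degree. *)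
have [|H0 [H0H1 H0m H0P]] := hitting_set_all (G := ~: H1) d_gt0 _
    (small (@var_supp n) (fun mo => d <= #|var_supp mo :&: ~: H1|)%N).
  by move=> S /mapP[mo]; rewrite mem_filter => /andP[? _] ->.
exists H1, H0; split=> // mo moP.
have [dT|/ltnW Td] := leqP d #|twin_supp mo|.
  by left; apply/H1P/map_f; rewrite mem_filter dT.
right; split=> //; have [dS|/ltnW Sd] := leqP d #|var_supp mo :&: ~: H1|.
  by left; apply/H0P/map_f; rewrite mem_filter dS.
by right.
Qed.

(** A falsified monomial is 0 at every [X :|: H1] with [X] avoiding [H0] and [H1]. A surviving one
    loses its variables in [H1] and its twins in [H0], which equal 1; at most [d] variables and [d]
    twins remain. *)
Lemma lowdeg_restricted (H1 H0 : {set 'I_n}) (mo : 'X_{1..n + n}) :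
  H0 \subset ~: H1 ->
  ~~ [disjoint H1 & twin_supp mo] \/ (#|twin_supp mo| <= d)%N /\
    (~~ [disjoint H0 & var_supp mo] \/ (#|var_supp mo :&: ~: H1| <= d)%N) ->
  lowdeg (~: (H0 :|: H1)) (d + d)
    (fun X => \prod_i point R (X :|: H1) i ^+ mo i).
Proof.
move=> H01 moP; set F := ~: _; set S := var_supp mo; set U := twin_supp mo.
have zero : (forall X : {set 'I_n}, X \subset F ->
    ~~ ((S \subset X :|: H1) && [disjoint U & X :|: H1])) ->
    lowdeg F (d + d) (fun X => \prod_i point R (X :|: H1) i ^+ mo i).
  move=> noX; have [c cE] := lowdeg0 R F (d + d); exists c => X XF.
  by rewrite -cE // meval_monomial (negPf (noX X XF)).
have [dU|dU] := boolP [disjoint H1 & U]; last first.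
  apply: zero => X _; apply: contra dU => /andP[_].
  rewrite disjoint_sym; apply: disjointWl; exact: subsetUr.
have [dS|dS] := boolP [disjoint H0 & S]; last first.
  apply: zero => X XF; apply: contra dS => /andP[SX _].
  rewrite disjoints_subset; apply/subsetP=> i iH0; rewrite inE.
  apply/negP=> /(subsetP SX); rewrite inE => /orP[/(subsetP XF)|iH1].
    by rewrite !inE iH0.
  by have := subsetP H01 _ iH0; rewrite inE iH1.
case: moP => [/negP//|[Ud [/negP//|Sd]]].
have [||| c cE] := @lowdeg_literals R _ F (d + d) (S :&: ~: H1) (U :&: ~: H0).
- by rewrite /F setCU setSI // -disjoints_subset disjoint_sym.
- by rewrite /F setCU setIC setIS // -disjoints_subset disjoint_sym.
- by apply: leq_add => //; apply: leq_trans Ud; apply/subset_leq_card/subsetIl.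
exists c => X XF; rewrite -cE // meval_monomial -/S -/U; congr _%:R; congr nat_of_bool.
have XH0 i : i \in X -> i \notin H0.
  by move/(subsetP XF); rewrite !inE negb_or => /andP[].
congr (_ && _).
  apply/subsetP/subsetP => h i; have := h i; rewrite !inE.
    by move=> hi /andP[/hi/orP[//|->]].
  by case: (i \in H1); rewrite ?orbT ?orbF ?andbT //.
rewrite !disjoints_subset; apply/subsetP/subsetP => h i; have := h i; rewrite !inE.
  by move=> hi /andP[/hi]; rewrite negb_or => /andP[].
move=> hi iU; have iU' : i \in U by rewrite inE.
rewrite negb_or (disjointFl dU iU') andbT.
by apply/negP=> iX; move: (hi); rewrite iU XH0 // iX => /(_ isT).
Qed.

(** If the size were smaller, the functional applied to the restricted identity would give -1 on the
    left and a nonnegative value on the right. *)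
Lemma monomial_size_lower_bound : (n ^ m <= monomial_size P * (n - d) ^ m)%N.
Proof.
rewrite leqNgt; apply/negP=> /restriction_exists[H1 [H0 [H01 H1m H0m moP]]].
(* Substituting [H1] in 2 #|Y| = k leaves #|X| = k/2 - #|H1|, a half-integer for odd [k]. *)
pose F := ~: (H0 :|: H1); pose rho : R := k%:R / 2%:R - #|H1|%:R.
pose e := weight #|F| rho.
have cF : (#|F| + (#|H0| + #|H1|) = n)%N.
  rewrite -[RHS]card_ord -(cardsC (H0 :|: H1)) addnC; congr (_ + _)%N.
  rewrite cardsU [H0 :&: H1](_ : _ = set0) ?cards0 ?subn0 //.
  by apply: disjoint_setI0; rewrite disjoints_subset.
have cFR : #|F|%:R + (#|H0|%:R + #|H1|%:R) = n%:R :> R by rewrite -!natrD cF.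
have H1mR : #|H1|%:R <= m%:R :> R by rewrite ler_nat.
have H0mR : #|H0|%:R <= m%:R :> R by rewrite ler_nat.
have knR : k%:R <= n%:R :> R by rewrite ler_nat.
have dmkR : 8 * d%:R + 2 * m%:R <= k%:R :> R by rewrite -!natrM -natrD ler_nat.
(* Squared polynomials have degree up to 2d, so positivity involves 4d literals. Both bounds reduce
   to k/2 - m >= 4d, the second one through k <= n. *)
have rho_ge : 4 * d%:R <= rho by rewrite /rho; lra.
have rho_le : 4 * d%:R <= #|F|%:R - rho by rewrite /rho; lra.
have low r : {subset msupp r <= monomials P} ->
    lowdeg F (d + d) (fun X => r.@[point R (X :|: H1)]).
  move=> rP; have [mo mor|c cE] := @lowdeg_sum R _ F _ (msupp r) (d + d)
      (fun mo X => r@_mo * \prod_i point R (X :|: H1) i ^+ mo i).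
    by apply/lowdegZ/lowdeg_restricted => //; apply/moP/rP.
  by exists c => X XF; rewrite mevalE cE.
have eD a b : (a + b < #|F|)%N -> e a b = e a.+1 b + e a b.+1.
  exact: weightD.
have eK a : (a < #|F|)%N ->
    (#|F|%:R - a%:R) * e a.+1 0 = (rho - a%:R) * e a 0.
  exact: weightK.
have e_ge0 a b : (a + b = d + d + (d + d))%N -> 0 <= e a b.
  move=> abd; have abdR : a%:R + b%:R = 4 * d%:R :> R.
    by rewrite -natrD abd !natrD; ring.
  have a0 : 0 <= a%:R :> R by [].
  have b0 : 0 <= b%:R :> R by [].
  by apply: weight_ge0; [lra|lra|lia].
have d_rho a : (a < d + d)%N -> a%:R < rho.
  rewrite -(ltr_nat R) natrD => ad; have d0 : 0 <= d%:R :> R by [].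
  by lra.
have DF : (d + d + (d + d) <= #|F|)%N by lia.
have sq r : r \in sos_s0 P -> 0 <= ev F e (fun X => r.@[point R (X :|: H1)] ^+ 2).
  move=> rP; apply: (ev_sqr_ge0 eD eK DF d_rho e_ge0); apply: low => mo mor.
  by rewrite mem_cat; apply/orP; left; apply/flattenP; exists (msupp r) => //; apply: map_f.
pose t := sos_t P ord0.
have lowt : lowdeg F (d + d) (fun X => t.@[point R (X :|: H1)]).
  by apply: low => mo mot; rewrite mem_cat mot orbT.
have ltDF : (d + d < #|F|)%N by lia.
have knap := ev_knapsack_lowdeg eD eK ltDF lowt.
have : ev F e (fun=> -1) = - 1.
  rewrite (@eq_ev _ _ _ _ _ (fun X => -1 * inc R set0 X)) => [|X _]; last first.
    by rewrite /inc sub0set mulr1.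
  by rewrite evZ (ev_inc eD) ?sub0set // cards0 /e weight00 mulr1.
rewrite (@eq_ev _ _ _ _ _ (fun X =>
   \sum_(r <- sos_s0 P) r.@[point R (X :|: H1)] ^+ 2 +
   2 * ((#|X|%:R - rho) * t.@[point R (X :|: H1)]))); last first.
  move=> X XF; rewrite (refutation_at P (X :|: H1)) -/t; congr (_ + _).
  have -> : #|X :|: H1| = (#|X| + #|H1|)%N.
    rewrite cardsU [X :&: H1](_ : _ = set0) ?cards0 ?subn0 //.
    apply: disjoint_setI0; rewrite disjoints_subset (subset_trans XF) //.
    by rewrite /F setCU subsetIr.
  by rewrite natrD /rho; field.
rewrite evD evZ knap mulr0 addr0 => E.
have : 0 <= ev F e (fun X => \sum_(r <- sos_s0 P) r.@[point R (X :|: H1)] ^+ 2).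
  rewrite /ev; under eq_bigr do rewrite mulr_sumr.
  by rewrite exchange_big big_seq; apply: sumr_ge0 => r /sq.
by rewrite E oppr_ge0 ler10.
Qed.

End LowerBound.

(** * Small sizes and the exponential form of the bound *)

(** This covers exponents at most 1. A refutation of size at most 1 has a single-monomial [t] and no
    nonzero square, which is refuted at the all-0 and all-1 points. *)
Lemma monomial_size_ge2 (R : realFieldType) (n k : nat)
    (P : knapsack_refutation R n k) : (0 < n)%N -> (1 < monomial_size P)%N.
Proof.
move=> n_gt0; rewrite ltnNge; apply/negP.
rewrite /monomial_size big_ord0 addn0 big_ord1.
pose t := sos_t P ord0; rewrite -/t [mon_size t]/mon_size => size_le1; have atY := refutation_at P.
have size_t : size (msupp t) = 1%N.
  have [t0|] := posnP (size (msupp t)); last by lia.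
  have := atY set0; rewrite -/t mevalE (size0nil t0) big_nil mul0r addr0.
  move/eqP; rewrite eq_sym => /eqP E; have := ler0N1 R; rewrite -E.
  by rewrite sumr_ge0 // => r _; apply: sqr_ge0.
have {}atY Y : -1 = t.@[point R Y] * (2 * #|Y|%:R - k%:R).
  rewrite {1}(atY Y) big_seq big1 ?add0r // => r rP.
  have /size0nil r0 : size (msupp r) = 0%N.
    move: size_le1; rewrite (big_rem r rP) /=.
    by rewrite size_t [mon_size r]/mon_size; lia.
  by rewrite mevalE r0 big_nil expr0n.
case mot : (msupp t) size_t => [|mo []] // _.
have tE Y : t.@[point R Y] =
    t@_mo * ((var_supp mo \subset Y) && [disjoint twin_supp mo & Y])%:R.
  by rewrite mevalE mot big_seq1 meval_monomial.
(* The monomial must be 1 at both points; its coefficient c then satisfies -c k = -1 = c (2n - k),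
   so c n = 0. *)
have E0 := atY set0; have E1 := atY setT.
rewrite !tE cards0 in E0; rewrite !tE cardsT card_ord in E1.
case: (_ && _) E0 => /= E0; last by move: E0; rewrite mulr0 mul0r; lra.
case: (_ && _) E1 => /= E1; last by move: E1; rewrite mulr0 mul0r; lra.
have n0 : n%:R != 0 :> R by rewrite pnatr_eq0 -lt0n.
have : t@_mo * n%:R = 0 by move: E0 E1; rewrite !mulr1 mulr0 sub0r mulrBr; lra.
by move/eqP; rewrite mulf_eq0 (negPf n0) orbF => /eqP t0; move: E0; rewrite t0; lra.
Qed.

(** Here 2 <= e comes from 1 + y <= exp y at y = 1. *)
Lemma powR2_le_expR (R : realType) (x : R) :
  0 <= x -> exp.powR 2 x <= sequences.expR x.
Proof.
move=> x0; rewrite /exp.powR pnatr_eq0 /= exp.ler_expR ler_piMr //.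
rewrite -[leRHS](@exp.expRK R) exp.ler_ln ?posrE ?exp.expR_gt0 //.
by have := exp.expR_ge1Dx (1 : R); lra.
Qed.

Theorem corollary3 (R : realType) :
  exists eps : R, 0 < eps /\
  exists N : nat, forall n : nat, (N <= n)%N ->
  forall k : nat, (1 <= k <= n)%N ->
  forall P : knapsack_refutation R n k,
  exp.powR 2%:R (eps * k%:R ^+ 2 / n%:R) <= (monomial_size P)%:R.
Proof.
(* The choice of [d] and [m] below makes d m about k^2 / 64; the remaining factor 4 absorbs the
   rounding. *)
exists (256%:R^-1); split; first by rewrite invr_gt0 ltr0n.
exists 0%N => n _ k /andP[k_gt0 kn] P.
have n_gt0 : (0 < n)%N by apply: leq_trans kn.
have nR : 0 < n%:R :> R by rewrite ltr0n.
set x := _ * _ / _.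
have xE : x * n%:R = 256%:R^-1 * k%:R ^+ 2 by rewrite /x divfK // gt_eqF.
have x_ge0 : 0 <= x.
  by rewrite /x divr_ge0 ?ler0n // mulr_ge0 ?invr_ge0 ?exprn_ge0 ?ler0n.
have knR : k%:R <= n%:R :> R by rewrite ler_nat.
have k0R : 0 <= k%:R :> R by [].
have [x_le1|x_gt1] := leP x 1.
  apply: (@le_trans _ _ 2%:R).
    by rewrite -[leRHS]exp.powRr1 // exp.ler_powR // ler1n.
  by rewrite ler_nat monomial_size_ge2.
(* An exponent above 1 means k^2 > 256 n >= 256 k. *)
have k_gt : (256 < k)%N.
  rewrite -(ltr_nat R) ltNge; apply/negP => k_le.
  have : x * n%:R <= n%:R.
    by rewrite xE; nra.
  by rewrite ger_pMl // leNgt x_gt1.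
(* Each of 8d and 2m is at most k/2, as the bound requires. *)
pose d := (k %/ 16)%N; pose m := (k %/ 4)%N.
have := @monomial_size_lower_bound R n k d m P.
move=> /(_ ltac:(lia) ltac:(lia) kn); set s := monomial_size P => size_ge.
have dn : (d <= n)%N by lia.
have dm : x <= d%:R / n%:R * m%:R.
  rewrite mulrAC ler_pdivlMr // xE -natrM -natrX ler_pdivrMl ?ltr0n //.
  rewrite -natrM ler_nat.
  have : (k <= 16 * d + 15)%N by lia.
  have : (k <= 4 * m + 3)%N by lia.
  by nia.
apply: le_trans (powR2_le_expR x_ge0) _.
apply: (@le_trans _ _ (sequences.expR (d%:R / n%:R * m%:R))).
  by rewrite exp.ler_expR.
(* This is 1 - y <= exp (- y) at y = d / n; its m-th power turns the counting bound into size >= exp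
   (d m / n). *)
have step : (n%:R - d%:R : R) <= n%:R * sequences.expR (- (d%:R / n%:R)).
  apply: le_trans (_ : n%:R * (1 + - (d%:R / n%:R)) <= _).
    by rewrite le_eqVlt; apply/orP; left; apply/eqP; field; rewrite gt_eqF.
  by rewrite ler_pM2l // exp.expR_ge1Dx.
have size_geR : (n%:R : R) ^+ m <= s%:R * (n%:R * sequences.expR (- (d%:R / n%:R))) ^+ m.
  apply: (@le_trans _ _ (s%:R * (n%:R - d%:R) ^+ m)).
    by rewrite -natrB // -!natrX -natrM ler_nat.
  rewrite ler_wpM2l // lerXn2r // nnegrE.
    by rewrite subr_ge0 ler_nat.
  by rewrite mulr_ge0 // exp.expR_ge0.
rewrite exprMn mulrCA ler_pMr ?exprn_gt0 // in size_geR.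
rewrite exp.expRN exprVn -exp.expRM_natr in size_geR.
by rewrite -ler_pdivrMr ?invr_gt0 ?exp.expR_gt0 // invrK mul1r in size_geR.
Qed.
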